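(* Let $I$ be a set of positive integers and let $\ell$ be a positive integer with $\ell\notin I$. Then there is no formula $\varphi\in\mathcal L_A(I)$ that is equivalent to $[A_\ell]p$ (for a propositional variable $p$).
   Context: Bimodal Kripke models $M=(W,R_1,R_2,\Pi)$, pointed models $(M,w)$. For a word $s=s_1\dots s_l\in\{1,2\}^*$, $w'$ is an $s$-successor of $w$ if there are $w=w_0,\dots,w_l=w'$ with $(w_{k-1},w_k)\in R_{s_k}$. A language $L\subseteq\{1,2\}^*$ yields the operator $[L]$: $M,w\models[L]\varphi$ iff $M,w'\models\varphi$ for every $s$-successor $w'$ of $w$ with $s\in L$. For $\ell\ge1$, $a^\ell_1$ and $a^\ell_2$ are the words of length $\ell$ over $\{1,2\}$ in which consecutive letters differ, starting with $1$ resp. $2$, and $A_\ell=\{a^\ell_1,a^\ell_2\}$. For a set $I$ of positive integers, $\mathcal L_A(I)$ is the logic with formulas $\varphi::=p\mid\neg\varphi\mid\varphi\vee\varphi\mid[A_k]\varphi$ ($k\in I$). Formulas are equivalent if they hold at the same pointed models. *)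

(* Defs.v *)
From Stdlib Require Import List Arith.
Import ListNotations.

Inductive letter : Set := one | two.

Definition other (a : letter) : letter :=
  match a with one => two | two => one end.

Definition word : Set := list letter.
Definition language : Type := word -> Prop.

(* [world] may be empty; a pointed model supplies the point separately. *)
Record model (V : Type) : Type := Model {
  world : Type;
  R1 : world -> world -> Prop;
  R2 : world -> world -> Prop;
  valuation : V -> world -> Prop
}.
Arguments world {V} _.
Arguments R1 {V} _ _ _.
Arguments R2 {V} _ _ _.
Arguments valuation {V} _ _ _.

Definition rel {V : Type} (M : model V) (a : letter) : world M -> world M -> Prop :=
  match a with one => R1 M | two => R2 M end.

Fixpoint successor {V : Type} (M : model V) (s : word) (w w' : world M) : Prop :=
  match s with
  | [] => w = w'
  | a :: s' => exists v : world M, rel M a w v /\ successor M s' v w'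
  end.

(* The ambient syntax has an operator [L] for every language L; the logics of
   interest are fragments of it. *)
Inductive formula (V : Type) : Type :=
| Var : V -> formula V
| Neg : formula V -> formula V
| Or : formula V -> formula V -> formula V
| Box : language -> formula V -> formula V.
Arguments Var {V} _.
Arguments Neg {V} _.
Arguments Or {V} _ _.
Arguments Box {V} _ _.

Fixpoint sat {V : Type} (M : model V) (w : world M) (phi : formula V) : Prop :=
  match phi with
  | Var p => valuation M p w
  | Neg psi => ~ sat M w psi
  | Or psi chi => sat M w psi \/ sat M w chi
  | Box L psi =>
      forall (s : word) (w' : world M), L s -> successor M s w w' -> sat M w' psi
  end.

Definition equivalent {V : Type} (phi psi : formula V) : Prop :=
  forall (M : model V) (w : world M), sat M w phi <-> sat M w psi.

Fixpoint alt (a : letter) (l : nat) : word :=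
  match l with
  | 0 => []
  | S l' => a :: alt (other a) l'
  end.

Definition A (l : nat) : language := fun s => s = alt one l \/ s = alt two l.

Inductive in_LA {V : Type} (I : nat -> Prop) : formula V -> Prop :=
| LA_Var : forall p : V, in_LA I (Var p)
| LA_Neg : forall phi : formula V, in_LA I phi -> in_LA I (Neg phi)
| LA_Or : forall phi psi : formula V,
    in_LA I phi -> in_LA I psi -> in_LA I (Or phi psi)
| LA_Box : forall (k : nat) (phi : formula V),
    I k -> in_LA I phi -> in_LA I (Box (A k) phi).

(* Main.v *)
(** Equality of levels up to [l] is a bisimulation for every [A k] with
    [k <> l] in the following model, yet two worlds of level [0] disagree on
    [[A l] p].  Every edge raises the level by one, never beyond [l], and
    variables fail exactly at level [l].  From a free world, every word leads
    upwards until level [l].  A trunk is an alternating path that stops just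
    below level [l]; it may be left for the free worlds, except at its root,
    but only by repeating the letter through which it was entered.  An
    alternating word starting above the root can therefore reach level [l] by
    leaving the trunk at its first letter, whereas an alternating word starting
    at the root can never leave the trunk. *)

Require Import Defs.
From Stdlib Require Import List Lia.

Section Bisimulation.

Context {V : Type}.

Definition language_successor (M : model V) (L : language) (x y : world M) : Prop :=
  exists s : word, L s /\ successor M s x y.

Lemma sat_Box (M : model V) (x : world M) (L : language) (phi : formula V) :
  sat M x (Box L phi) <->
  forall y : world M, language_successor M L x y -> sat M y phi.
Proof.
  split.
  - intros H y (s & Hs & Hy); exact (H s y Hs Hy).
  - intros H s y Hs Hy; apply H; exists s; auto.
Qed.

Fixpoint in_fragment (F : language -> Prop) (phi : formula V) : Prop :=
  match phi with
  | Var _ => True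
  | Neg psi => in_fragment F psi
  | Or psi chi => in_fragment F psi /\ in_fragment F chi
  | Box L psi => F L /\ in_fragment F psi
  end.

Record bisimulation (F : language -> Prop) (M N : model V)
    (Z : world M -> world N -> Prop) : Prop := {
  bisimulation_atoms : forall x y p,
    Z x y -> valuation M p x <-> valuation N p y;
  bisimulation_forth : forall L x y x',
    F L -> Z x y -> language_successor M L x x' ->
    exists y', language_successor N L y y' /\ Z x' y';
  bisimulation_back : forall L x y y',
    F L -> Z x y -> language_successor N L y y' ->
    exists x', language_successor M L x x' /\ Z x' y'
}.

Lemma symmetric_bisimulation (F : language -> Prop) (M : model V)
    (Z : world M -> world M -> Prop) :
  (forall x y, Z x y -> Z y x) ->
  (forall x y p, Z x y -> valuation M p x -> valuation M p y) ->
  (forall L x y x', F L -> Z x y -> language_successor M L x x' ->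
     exists y', language_successor M L y y' /\ Z x' y') ->
  bisimulation F M M Z.
Proof.
  intros Zsym atoms forth; split.
  - intros x y p Hxy; split; apply atoms; auto.
  - exact forth.
  - intros L x y y' HL Hxy Hy'.
    destruct (forth L y x y') as (x' & Hx' & Hyx'); auto.
    exists x'; auto.
Qed.

Lemma bisimulation_sat (F : language -> Prop) (M N : model V)
    (Z : world M -> world N -> Prop) (phi : formula V) :
  bisimulation F M N Z -> in_fragment F phi ->
  forall x y, Z x y -> sat M x phi <-> sat N y phi.
Proof.
  intros [atoms forth back].
  induction phi as [p|psi IH|psi IHpsi chi IHchi|L psi IH]; intros Hphi x y Hxy.
  - now apply atoms.
  - simpl; now rewrite (IH Hphi x y Hxy).
  - destruct Hphi as [Hpsi Hchi]; simpl.
    now rewrite (IHpsi Hpsi x y Hxy), (IHchi Hchi x y Hxy).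
  - destruct Hphi as [HL Hpsi]; rewrite !sat_Box; split.
    + intros Hx y' Hy'.
      destruct (back L x y y' HL Hxy Hy') as (x' & Hx' & Hxy').
      apply (IH Hpsi x' y' Hxy'); auto.
    + intros Hy x' Hx'.
      destruct (forth L x y x' HL Hxy Hx') as (y' & Hy' & Hxy').
      apply (IH Hpsi x' y' Hxy'); auto.
Qed.

Lemma successor_invariant (M : model V) (P : world M -> Prop) :
  (forall a x y, rel M a x y -> P x -> P y) ->
  forall s x y, successor M s x y -> P x -> P y.
Proof.
  intros HP s; induction s as [|a s IH]; simpl; intros x y H Hx.
  - now subst.
  - destruct H as (v & Hv & H); eauto.
Qed.

Lemma graded_successor (M : model V) (grade : world M -> nat) :
  (forall a x y, rel M a x y -> grade y = S (grade x)) ->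
  forall s x y, successor M s x y -> grade y = grade x + length s.
Proof.
  intros Hgrade s; induction s as [|a s IH]; simpl; intros x y H.
  - subst; lia.
  - destruct H as (v & Hv & H).
    apply Hgrade in Hv; apply IH in H; lia.
Qed.

End Bisimulation.

Lemma letter_neq_other (a : letter) : a <> other a.
Proof. now destruct a. Qed.

Lemma length_alt (a : letter) (k : nat) : length (alt a k) = k.
Proof. revert a; induction k as [|k IH]; intro a; simpl; auto. Qed.

Lemma in_A_iff (k : nat) (s : word) : A k s <-> exists a, s = alt a k.
Proof.
  split.
  - intros [-> | ->]; eauto.
  - intros [[] ->]; [left | right]; reflexivity.
Qed.

Definition A_languages (I : nat -> Prop) (L : language) : Prop :=
  exists k, I k /\ L = A k.

Lemma in_LA_in_fragment (V : Type) (I : nat -> Prop) (phi : formula V) :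
  in_LA I phi -> in_fragment (A_languages I) phi.
Proof. unfold A_languages; induction 1; simpl; eauto. Qed.

Inductive trunk_world : Set :=
| Free (i : nat)
| Trunk (i : nat) (a : letter).

Definition level (x : trunk_world) : nat :=
  match x with Free i | Trunk i _ => i end.

(* [Trunk i a] continues the trunk by [a], so it was entered by [other a]. *)
Inductive trunk_step (l : nat) : letter -> trunk_world -> trunk_world -> Prop :=
| free_step i a :
    i < l -> trunk_step l a (Free i) (Free (S i))
| stay_step i a :
    S i < l -> trunk_step l a (Trunk i a) (Trunk (S i) (other a))
| leave_step i a :
    0 < i < l -> trunk_step l (other a) (Trunk i a) (Free (S i)).

Definition trunk_model (V : Type) (l : nat) : model V :=
  Model V trunk_world (trunk_step l one) (trunk_step l two)
    (fun _ x => level x <> l).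

Section TrunkModel.

Variables (V : Type) (l : nat).
Notation M := (trunk_model V l).

Lemma rel_trunk_model (a : letter) : rel M a = trunk_step l a.
Proof. now destruct a. Qed.

Lemma successor_level (s : word) (x y : world M) :
  successor M s x y -> level y = level x + length s.
Proof.
  apply (graded_successor M level); intros a v w.
  rewrite rel_trunk_model; now destruct 1.
Qed.

Lemma successor_level_bound (s : word) (x y : world M) :
  successor M s x y -> level x <= l -> level y <= l.
Proof.
  apply (successor_invariant M (fun z => level z <= l)); intros a v w.
  rewrite rel_trunk_model; destruct 1; simpl; lia.
Qed.

Lemma A_successor_level (k : nat) (x y : world M) :
  language_successor M (A k) x y -> level y = level x + k.
Proof.
  intros (s & Hs & Hy); apply in_A_iff in Hs as [a ->].
  now rewrite (successor_level _ _ _ Hy), length_alt.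
Qed.

Lemma free_successor (s : word) (i : nat) :
  i + length s <= l -> exists y, successor M s (Free i) y.
Proof.
  revert i; induction s as [|a s IH]; simpl; intros i H.
  - eauto.
  - destruct (IH (S i)) as [y Hy]; [lia|].
    exists y, (Free (S i)); rewrite rel_trunk_model.
    split; [constructor; lia | exact Hy].
Qed.

Lemma trunk_alt_successor (k i : nat) (a : letter) :
  i + k < l -> exists y, successor M (alt a k) (Trunk i a) y.
Proof.
  revert i a; induction k as [|k IH]; simpl; intros i a H.
  - eauto.
  - destruct (IH (S i) (other a)) as [y Hy]; [lia|].
    exists y, (Trunk (S i) (other a)); rewrite rel_trunk_model.
    split; [constructor; lia | exact Hy].
Qed.

Lemma leaving_successor (s : word) (i : nat) (a : letter) :
  0 < i -> i + S (length s) <= l ->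
  exists y, successor M (other a :: s) (Trunk i a) y.
Proof.
  intros Hi H; destruct (free_successor s (S i)) as [y Hy]; [lia|].
  exists y, (Free (S i)); rewrite rel_trunk_model.
  split; [constructor; lia | exact Hy].
Qed.

Lemma A_successor_exists (k : nat) (x : world M) :
  k <> l -> level x + k <= l -> exists y, language_successor M (A k) x y.
Proof.
  intros Hk H.
  enough (exists a y, successor M (alt a k) x y) as (a & y & Hy).
  { exists y, (alt a k); rewrite in_A_iff; eauto. }
  destruct x as [i | [|i] a]; simpl in H.
  - exists one; apply free_successor; now rewrite length_alt.
  - exists a; apply trunk_alt_successor; simpl; lia.
  - exists (other a); destruct k as [|k]; simpl alt.
    + now exists (Trunk (S i) a).
    + apply leaving_successor; rewrite ?length_alt; lia.
Qed.

Lemma step_along_trunk (i : nat) (a : letter) (x : trunk_world) :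
  trunk_step l a (Trunk i a) x -> x = Trunk (S i) (other a) /\ S i < l.
Proof.
  inversion 1; subst.
  - auto.
  - exfalso; eapply letter_neq_other; eassumption.
Qed.

Lemma trunk_alt_successor_level (k i : nat) (a : letter) (y : world M) :
  i < l -> successor M (alt a k) (Trunk i a) y -> level y < l.
Proof.
  revert i a; induction k as [|k IH]; intros i a Hi H; simpl in H.
  - now subst.
  - destruct H as (v & Hv & H); rewrite rel_trunk_model in Hv.
    apply step_along_trunk in Hv as [-> Hstay].
    exact (IH _ _ Hstay H).
Qed.

Lemma root_step_letter (a b : letter) (y : trunk_world) :
  trunk_step l b (Trunk 0 a) y -> b = a.
Proof. inversion 1; subst; [reflexivity | lia]. Qed.

Lemma root_A_successor_level (k : nat) (a : letter) (y : world M) :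
  0 < l -> language_successor M (A k) (Trunk 0 a) y -> level y < l.
Proof.
  intros Hl (s & Hs & Hy); apply in_A_iff in Hs as [b ->].
  destruct k as [|k].
  - now simpl in Hy; subst.
  - assert (b = a) as ->.
    { destruct Hy as (v & Hv & _); rewrite rel_trunk_model in Hv.
      exact (root_step_letter _ _ _ Hv). }
    exact (trunk_alt_successor_level _ _ _ _ Hl Hy).
Qed.

Definition same_level (x y : trunk_world) : Prop :=
  level x = level y /\ level x <= l.

Lemma same_level_bisimulation (I : nat -> Prop) :
  ~ I l -> bisimulation (A_languages I) M M same_level.
Proof.
  intros HI; apply symmetric_bisimulation.
  - unfold same_level; lia.
  - intros x y p [Hxy _]; simpl; congruence.
  - intros L x y x' (k & Hk & ->) [Hxy Hx] Hx'.
    assert (Hlevel : level x' = level x + k) by now apply A_successor_level.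
    assert (Hbound : level x' <= l).
    { destruct Hx' as (s & _ & Hs); exact (successor_level_bound _ _ _ Hs Hx). }
    destruct (A_successor_exists k y) as [y' Hy']; [congruence | lia |].
    exists y'; split; [exact Hy'|].
    apply A_successor_level in Hy'; unfold same_level; lia.
Qed.

Lemma root_sat_Box_A (a : letter) (p : V) :
  0 < l -> sat M (Trunk 0 a) (Box (A l) (Var p)).
Proof.
  intros Hl; apply sat_Box; intros y Hy.
  apply root_A_successor_level in Hy; [simpl; lia | exact Hl].
Qed.

Lemma free_not_sat_Box_A (p : V) : ~ sat M (Free 0) (Box (A l) (Var p)).
Proof.
  rewrite sat_Box; intros Hsat.
  destruct (free_successor (alt one l) 0) as [y Hy]; [now rewrite length_alt|].
  assert (HyA : language_successor M (A l) (Free 0) y).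
  { exists (alt one l); rewrite in_A_iff; eauto. }
  exact (Hsat y HyA (A_successor_level _ _ _ HyA)).
Qed.

End TrunkModel.

Theorem theorem8 (V : Type) (I : nat -> Prop) (I_pos : forall k : nat, I k -> 0 < k)
    (l : nat) (l_pos : 0 < l) (l_notin : ~ I l) (p : V) :
  ~ exists phi : formula V, in_LA I phi /\ equivalent phi (Box (A l) (Var p)).
Proof.
  intros (phi & Hphi & Heq).
  assert (Hroots : same_level l (Trunk 0 one) (Free 0)) by (split; simpl; lia).
  apply (free_not_sat_Box_A V l p), Heq.
  apply (bisimulation_sat _ _ _ _ phi (same_level_bisimulation V l I l_notin)
           (in_LA_in_fragment V I phi Hphi) _ _ Hroots).
  apply Heq, (root_sat_Box_A V l one p l_pos).
Qed.
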